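(* An algebra $(X,\circ,\backslash_\circ)$ is a $2$-reductive rack if and only if it is the sum of some trivial affine mesh. The orbits of the action of $\mathrm{LMlt}(X)$ on $X$ then coincide with the groups of the mesh.
   Context: Algebras are non-empty. A left quasigroup is an algebra $(X,\circ,\backslash_\circ)$ with two binary operations such that $x\circ(x\backslash_\circ y)=y=x\backslash_\circ(x\circ y)$ for all $x,y\in X$; equivalently all left translations $L_x(a)=x\circ a$ are bijections, with $L_x^{-1}(a)=x\backslash_\circ a$. A rack is a left quasigroup with $x\circ(y\circ z)=(x\circ y)\circ(x\circ z)$ for all $x,y,z$. A left quasigroup is $2$-reductive if $(x\circ y)\circ z=y\circ z$ for all $x,y,z$. The left multiplication group is $\mathrm{LMlt}(X)=\langle L_x\colon x\in X\rangle$, acting on $X$ as a permutation group. A trivial affine mesh over a non-empty set $I$ is a pair $((A_i)_{i\in I},(c_{i,j})_{i,j\in I})$, where the $A_i$ are abelian groups and $c_{i,j}\in A_j$ are constants such that $A_j=\langle\{c_{i,j}\mid i\in I\}\rangle$ for every $j\in I$. Its sum is the algebra $(\bigcup_{i\in I}A_i,\circ,\backslash_\circ)$ on the disjoint union of the sets $A_i$, with $a\circ b=b+c_{i,j}$ and $a\backslash_\circ b=b-c_{i,j}$ for $a\in A_i$, $b\in A_j$. *)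

(* Defs.v *)
From mathcomp Require Import all_boot all_algebra.
From mathcomp Require Import boolp classical_sets.
Set Implicit Arguments.
Unset Strict Implicit.
Unset Printing Implicit Defensive.
Import GRing.Theory.
Local Open Scope classical_set_scope.
Local Open Scope ring_scope.

Record algebra := Algebra {
  carrier :> Type;
  op : carrier -> carrier -> carrier;
  ldiv : carrier -> carrier -> carrier;
  algebra_nonempty : inhabited carrier }.

Definition left_quasigroup (X : algebra) : Prop :=
  forall x y : X, op x (ldiv x y) = y /\ ldiv x (op x y) = y.

Definition rack (X : algebra) : Prop :=
  left_quasigroup X /\
  forall x y z : X, op x (op y z) = op (op x y) (op x z).

Definition two_reductive (X : algebra) : Prop :=
  forall x y z : X, op (op x y) z = op y z.

Definition algebra_iso (X Y : algebra) (f : X -> Y) : Prop :=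
  [/\ bijective f,
      forall x y : X, f (op x y) = op (f x) (f y)
    & forall x y : X, f (ldiv x y) = ldiv (f x) (f y)].

(* Composition and inverses are those of the symmetric group, realized on
   plain functions. *)
Definition perm_group (T : Type) (G : set (T -> T)) : Prop :=
  [/\ forall f, G f -> bijective f,
      G id,
      forall f g, G f -> G g -> G (f \o g)
    & forall f g, G f -> cancel f g -> cancel g f -> G g].

(* When some left translation is not a bijection, no permutation group contains
   them all and [LMlt X] is degenerate (everything). *)
Definition LMlt (X : algebra) : set (X -> X) :=
  smallest (@perm_group X) (range (@op X)).
Arguments LMlt : clear implicits.

Definition orbit_of (T : Type) (G : set (T -> T)) (x : T) : set T :=
  [set f x | f in G].

Definition orbits (T : Type) (G : set (T -> T)) : set (set T) :=
  range (orbit_of G).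

Definition subgroup_gen (A : zmodType) (S : set A) : set A :=
  smallest (fun H : set A => zmod_closed [pred x | x \in H]) S.

Record trivial_affine_mesh (I : Type) := TrivialAffineMesh {
  mesh_grp : I -> zmodType;
  mesh_cst : forall i j : I, mesh_grp j;
  mesh_index_nonempty : inhabited I;
  mesh_generated : forall j : I,
    subgroup_gen (range (fun i : I => mesh_cst i j)) = [set: mesh_grp j] }.

Section MeshSum.
Variables (I : Type) (M : trivial_affine_mesh I).

Definition mesh_sum_carrier : Type := {i : I & mesh_grp M i}.

Definition mesh_sum_op (a b : mesh_sum_carrier) : mesh_sum_carrier :=
  Tagged (mesh_grp M) (tagged b + mesh_cst M (tag a) (tag b)).

Definition mesh_sum_ldiv (a b : mesh_sum_carrier) : mesh_sum_carrier :=
  Tagged (mesh_grp M) (tagged b - mesh_cst M (tag a) (tag b)).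

Lemma mesh_sum_nonempty : inhabited mesh_sum_carrier.
Proof. by case: (mesh_index_nonempty M) => i; exists; exists i; exact: 0. Qed.

Definition mesh_sum : algebra :=
  Algebra mesh_sum_op mesh_sum_ldiv mesh_sum_nonempty.

Definition mesh_block (i : I) : set mesh_sum :=
  range (fun a : mesh_grp M i => Tagged (mesh_grp M) a).

End MeshSum.

Arguments mesh_block {I} M i.

(* Main.v *)
Require Import Defs.
From HB Require Import structures.
From mathcomp Require Import all_boot all_algebra.
From mathcomp Require Import boolp classical_sets.
Local Open Scope classical_set_scope.

(** In a 2-reductive rack, self-distributivity reads
    [x o (y o z) = (x o y) o (x o z) = y o (x o z)], so the left translations
    commute and [LMlt X] is abelian (LMlt_commute); moreover points of the same
    orbit have the same left translation (op_LMlt).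

    An abelian permutation group is determined on an orbit by the image of one
    point, so once a base point [e] is chosen the orbit becomes an abelian group
    with zero [e], in which adding [g e] is applying [g] (val_orbitD). The mesh
    is indexed by the orbits, its groups are the orbits, and its constant
    [c_{O,O'}] is the image of the base point of [O'] under the common left
    translation [L] of the points of [O]. Then [L b = c_{O,O'} + b] on [O'],
    which is the operation of the sum (orbit_mesh_val_op). The constants
    generate each orbit because the left translations generate [LMlt X]
    (orbit_generated).

    Conversely the identities hold in a sum by inspection. There, left
    translations preserve the blocks, so an orbit lies inside a block
    (LMlt_tag). In the block [A_j], the elements by which some member of
    [LMlt X] translates form a subgroup containing every [c_{i,j}], hence are
    all of [A_j] (LMlt_translation), and the orbit fills the block. *)

Set Implicit Arguments.
Unset Strict Implicit.
Unset Printing Implicit Defensive.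
Import GRing.Theory.
Local Open Scope ring_scope.

(** * Permutation groups and their orbits *)

Lemma bijective_inj_surj (S T : Type) (f : S -> T) :
  injective f -> (forall y, exists x, f x = y) -> bijective f.
Proof.
move=> f_inj f_surj; exists (fun y => sval (cid (f_surj y))) => [x|y].
- exact/f_inj/(svalP (cid (f_surj (f x)))).
- exact: (svalP (cid (f_surj y))).
Qed.

Lemma perm_group_bijective (T : Type) :
  perm_group [set f : T -> T | bijective f].
Proof.
split=> //=; first by exists id.
- by move=> f g; exact: bij_comp.
- by move=> f g _ fK gK; exists f.
Qed.

Lemma perm_group_centralizer (T : Type) (S : set (T -> T)) :
  perm_group [set f | bijective f /\ forall g, S g -> forall t, f (g t) = g (f t)].
Proof.
split=> /=.
- by move=> f [].
- by split=> //; exists id.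
- move=> f g [f_bij fC] [g_bij gC]; split; first exact: bij_comp.
  by move=> h Sh t /=; rewrite (gC h Sh) (fC h Sh).
- move=> f g [_ fC] fK gK; split; first by exists f.
  by move=> h Sh t; rewrite -{1}(gK t) -(fC h Sh) fK.
Qed.

Lemma orbit_of_refl (T : Type) (G : set (T -> T)) x :
  perm_group G -> orbit_of G x x.
Proof. by case=> _ G1 _ _; exists id. Qed.

Lemma orbit_of_eq (T : Type) (G : set (T -> T)) x y :
  perm_group G -> orbit_of G x y -> orbit_of G x = orbit_of G y.
Proof.
move=> [Gbij _ GM GV] [g Gg <-]; have [h gK hK] := Gbij g Gg.
have Gh := GV g h Gg gK hK.
apply/seteqP; split=> _ [k Gk <-].
- by exists (k \o h); [exact: GM | rewrite /= gK].
- by exists (k \o g); [exact: GM | ].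
Qed.

(** * The group carried by an orbit of a commutative permutation group *)

Section OrbitGroup.
Variables (T : Type) (G : set (T -> T)).
Hypothesis Ggrp : perm_group G.
Hypothesis GC : forall g h, G g -> G h -> forall t, g (h t) = h (g t).
Variable e : T.

Definition orbit_group : Type := set_type (orbit_of G e).

HB.instance Definition _ := gen_eqMixin orbit_group.
HB.instance Definition _ := gen_choiceMixin orbit_group.

Implicit Types y z : orbit_group.

Definition orbit_point g (Gg : G g) : orbit_group :=
  SigSub (mem_set (imageP (fun f : T -> T => f e) Gg)).

(** The chosen member of [G] is immaterial on the orbit: as [G] is commutative,
    if [g e = h e] then [g (k e) = k (g e) = k (h e) = h (k e)]. *)
Definition orbit_perm y : T -> T := s2val (cid2 (set_mem (valP y))).

Lemma orbit_perm_in y : G (orbit_perm y).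
Proof. by rewrite /orbit_perm; case: cid2. Qed.

Lemma orbit_perm_base y : orbit_perm y e = val y.
Proof. by rewrite /orbit_perm; case: cid2. Qed.

Definition orbit_zero : orbit_group :=
  orbit_point (let: And4 _ G1 _ _ := Ggrp in G1).

Definition orbit_add y z : orbit_group :=
  orbit_point (let: And4 _ _ GM _ := Ggrp in
               GM _ _ (orbit_perm_in y) (orbit_perm_in z)).

Lemma orbit_inv_subproof y : exists2 g, G g & orbit_perm y (g e) = e.
Proof.
case: Ggrp => Gbij _ _ GV; have [g gK Kg] := Gbij _ (orbit_perm_in y).
by exists g; [exact: (GV _ _ (orbit_perm_in y)) | rewrite Kg].
Qed.

Definition orbit_opp y : orbit_group :=
  orbit_point (s2valP (cid2 (orbit_inv_subproof y))).

(** Independence of the sum from the choice made by [orbit_perm]: any [g]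
    sending [e] to [y] computes [y + z]. *)
Lemma val_orbit_addl g y z : G g -> g e = val y ->
  val (orbit_add y z) = g (val z).
Proof.
move=> Gg gy; rewrite /= (GC (orbit_perm_in y) (orbit_perm_in z)) /=.
by rewrite orbit_perm_base -gy (GC (orbit_perm_in z) Gg) /= orbit_perm_base.
Qed.

Lemma orbit_addC : commutative orbit_add.
Proof.
move=> y z; apply: val_inj; rewrite /=.
exact: (GC (orbit_perm_in y) (orbit_perm_in z)).
Qed.

Lemma orbit_addA : associative orbit_add.
Proof.
move=> x y z; apply: val_inj.
have [_ _ GM _] := Ggrp; have [Gx Gy] := (orbit_perm_in x, orbit_perm_in y).
rewrite (val_orbit_addl (y := orbit_add x y) z (GM _ _ Gx Gy)) //.
rewrite (val_orbit_addl _ Gx) ?orbit_perm_base //.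
by rewrite (val_orbit_addl _ Gy) ?orbit_perm_base.
Qed.

Lemma orbit_add0 : left_id orbit_zero orbit_add.
Proof.
move=> y; apply: val_inj; have [_ G1 _ _] := Ggrp.
by rewrite (val_orbit_addl y G1).
Qed.

Lemma orbit_addN : left_inverse orbit_zero orbit_opp orbit_add.
Proof.
move=> y; rewrite orbit_addC; apply: val_inj.
rewrite (val_orbit_addl _ (orbit_perm_in y)) ?orbit_perm_base //=.
by case: cid2.
Qed.

(** Packed explicitly rather than as a canonical instance on [orbit_group],
    whose type does not record the proofs [Ggrp] and [GC] that the group law
    depends on. *)
Definition orbit_zmodType : zmodType :=
  HB.pack orbit_group (GRing.isZmodule.Build orbit_group
    orbit_addA orbit_addC orbit_add0 orbit_addN).

Lemma val_orbitD g (y z : orbit_zmodType) : G g -> g e = val y ->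
  val (y + z) = g (val z).
Proof. exact: val_orbit_addl. Qed.

(** For a subgroup [H], the members of [G] sending the base point into [H] form
    a permutation group, since [(f \o g) e = f e + g e]. If [H] contains [s],
    this permutation group contains [S], so it is all of [G]. *)
Lemma orbit_generated (S : set (T -> T)) (s : set orbit_zmodType) :
    G = smallest (@perm_group T) S ->
    (forall f, S f -> exists2 c, s c & val c = f e) ->
  subgroup_gen s = [set: orbit_zmodType].
Proof.
move=> GS sS; apply/seteqP; split=> // y _ H [/= Hz sH].
have [H0 HB] := Hz; have [Gbij G1 GM GV] := Ggrp.
pose P := [set g | G g /\ exists2 c : orbit_zmodType, H c & val c = g e].
suff /(_ _ (orbit_perm_in y)) [_ [c Hc cy]] : G `<=` P.
  suff <- : c = y by [].
  by apply: val_inj; rewrite cy orbit_perm_base.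
rewrite {1}GS; apply: smallest_sub; last first.
  move=> f Sf; split; first by rewrite GS; exact: sub_gen_smallest.
  by have [c /sH Hc cE] := sS f Sf; exists c.
split.
- by move=> g [/Gbij].
- by split=> //; exists 0 => //; have := H0; rewrite inE.
- move=> f g [Gf [c Hc cE]] [Gg [d Hd dE]]; split; first exact: GM.
  exists (c + d); last by rewrite (val_orbitD _ Gf) // dE.
  have HN : H (- d) by have := HB 0 d H0; rewrite !inE sub0r; apply.
  by have := HB c (- d); rewrite !inE opprK; apply.
- move=> f g [Gf [c Hc cE]] fK gK; have Gg := GV f g Gf fK gK.
  split=> //; exists (- c).
    by have := HB 0 c H0; rewrite !inE sub0r; apply.
  apply: (can_inj fK).
  by rewrite -(val_orbitD (- c) Gf (esym cE)) subrr gK.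
Qed.

End OrbitGroup.

(** * The left multiplication group *)

Lemma left_quasigroup_bij (X : algebra) (x : X) :
  left_quasigroup X -> bijective (op x).
Proof. by move=> lq; exists (ldiv x) => y; case: (lq x y). Qed.

Lemma LMlt_op (X : algebra) (x : X) : LMlt X (op x).
Proof. by apply: sub_gen_smallest; exists x. Qed.

Lemma LMlt_sub (X : algebra) (P : set (X -> X)) :
  perm_group P -> (forall x, P (op x)) -> LMlt X `<=` P.
Proof. by move=> Pgrp Pop; apply: smallest_sub => // _ [x _ <-]. Qed.

Lemma LMlt_perm_group (X : algebra) :
  left_quasigroup X -> perm_group (LMlt X).
Proof.
move=> lq; split.
- apply: LMlt_sub; first exact: perm_group_bijective.
  by move=> x; exact: left_quasigroup_bij.
- by move=> P [[]].
- by move=> f g Gf Gg P PP; have [[_ _ + _] _] := PP; apply; [exact: Gf|exact: Gg].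
- move=> f g Gf fK gK P PP; have [[_ _ _ +] _] := PP; apply; last exact: gK.
    exact: Gf.
  exact: fK.
Qed.

Section TwoReductiveRack.
Variable X : algebra.
Hypotheses (rackX : rack X) (redX : two_reductive X).

Lemma op_commute (x y z : X) : op x (op y z) = op y (op x z).
Proof. by rewrite rackX.2 redX. Qed.

(** Two passes through the centralizer: each left translation commutes with all
    generators, so every member of [LMlt X] commutes with the generators; then
    the generators centralize [LMlt X], and so does [LMlt X] itself. *)
Lemma LMlt_commute (g h : X -> X) :
  LMlt X g -> LMlt X h -> forall t, g (h t) = h (g t).
Proof.
have opG f : LMlt X f -> forall x t, f (op x t) = op x (f t).
  move=> Gf x t.
  have := LMlt_sub (perm_group_centralizer (range (@op X))) _ Gf.
  case=> [y|_]; last by apply; exists x.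
  split; first exact: left_quasigroup_bij rackX.1.
  by move=> _ [z _ <-] u; exact: op_commute.
move=> Gg Gh t; have := LMlt_sub (perm_group_centralizer (LMlt X)) _ Gg.
case=> [y|_]; last exact.
split; first exact: left_quasigroup_bij rackX.1.
by move=> f Gf u; rewrite opG.
Qed.

(** 2-reductivity is the case of a generator [g]; the permutations [g] with this
    property form a group. *)
Lemma op_LMlt (g : X -> X) : LMlt X g -> forall x, op (g x) = op x.
Proof.
move=> Gg; have := LMlt_sub _ _ Gg.
move=> /(_ [set f | bijective f /\ forall x, op (f x) = op x]) [||//].
  split=> /=; first by move=> f [].
  - by split=> //; exists id.
  - move=> f h [f_bij fE] [h_bij hE]; split; first exact: bij_comp.
    by move=> x /=; rewrite fE hE.
  - move=> f h [_ fE] fK hK; split; first by exists f.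
    by move=> x; rewrite -{2}(hK x) fE.
move=> y; split; first exact: left_quasigroup_bij rackX.1.
by move=> x; apply/funext => z; exact: redX.
Qed.

(** * The mesh of orbits *)

Let G := LMlt X.
Let Ggrp : perm_group G := LMlt_perm_group rackX.1.

Definition orbit_index : Type := set_type (orbits G).

Definition orbit_base (O : orbit_index) : X :=
  s2val (cid2 (set_mem (valP O))).

Lemma orbit_baseE (O : orbit_index) : orbit_of G (orbit_base O) = val O.
Proof. by rewrite /orbit_base; case: cid2. Qed.

Definition orbit_cst (O O' : orbit_index) :
    orbit_zmodType Ggrp LMlt_commute (orbit_base O') :=
  orbit_point (orbit_base O') (LMlt_op (orbit_base O)).

Lemma orbit_op_base (O : orbit_index) (x : X) :
  val O x -> op x = op (orbit_base O).
Proof. by rewrite -orbit_baseE => -[g Gg <-]; exact: op_LMlt. Qed.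

Lemma orbit_of_index (x : X) : {O : orbit_index | val O = orbit_of G x}.
Proof. by exists (SigSub (mem_set (imageT (orbit_of G) x))). Qed.

Lemma orbit_index_nonempty : inhabited orbit_index.
Proof. by case: (algebra_nonempty X) => x; exists; case: (orbit_of_index x). Qed.

(** A left translation [op x] sends the base point of [O'] to the constant
    indexed by the orbit of [x]. *)
Lemma orbit_cst_generated (O' : orbit_index) :
  subgroup_gen (range (orbit_cst^~ O')) = [set: _].
Proof.
apply: (orbit_generated (S := range (@op X))) => // _ [x _ <-].
have [O OE] := orbit_of_index x.
exists (orbit_cst O O'); first by exists O.
rewrite /= (@orbit_op_base O x) // OE; exact: orbit_of_refl.
Qed.

Definition orbit_mesh : trivial_affine_mesh orbit_index :=
  TrivialAffineMesh orbit_index_nonempty orbit_cst_generated.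

Definition orbit_mesh_val (a : mesh_sum orbit_mesh) : X :=
  val (tagged a : orbit_group G (orbit_base (tag a))).

Lemma orbit_mesh_val_in (a : mesh_sum orbit_mesh) :
  val (tag a) (orbit_mesh_val a).
Proof. by rewrite -orbit_baseE; exact: set_mem (valP _). Qed.

Lemma orbit_mesh_val_bij : bijective orbit_mesh_val.
Proof.
apply: bijective_inj_surj => [a b ab|x].
  have tab : tag a = tag b.
    apply: val_inj; rewrite /= -!orbit_baseE.
    have := orbit_mesh_val_in a; have := orbit_mesh_val_in b.
    rewrite -ab -!orbit_baseE => /(orbit_of_eq Ggrp) ->.
    by move=> /(orbit_of_eq Ggrp) ->.
  case: a b tab ab => [O y] [O' y'] /= OO'; case: O' / OO' y' => y'.
  by rewrite /orbit_mesh_val /= => /val_inj ->.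
have [O OE] := orbit_of_index x.
have Ox : orbit_of G (orbit_base O) x.
  by rewrite orbit_baseE OE; exact: orbit_of_refl.
by exists (existT _ O (SigSub (mem_set Ox))).
Qed.

Lemma orbit_mesh_val_op (a b : mesh_sum orbit_mesh) :
  orbit_mesh_val (op a b) = op (orbit_mesh_val a) (orbit_mesh_val b).
Proof.
rewrite (orbit_op_base (orbit_mesh_val_in a)).
pose c := mesh_cst orbit_mesh (tag a) (tag b).
rewrite -[RHS](val_orbitD (y := c) (tagged b) (LMlt_op _)) //.
by rewrite addrC.
Qed.

(** In a left quasigroup the division is determined by the operation, so an
    isomorphism for [op] is one for [ldiv]. *)
Lemma orbit_mesh_iso : algebra_iso orbit_mesh_val.
Proof.
split; [exact: orbit_mesh_val_bij | exact: orbit_mesh_val_op | move=> a b].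
have [_ <-] := rackX.1 (orbit_mesh_val a) (orbit_mesh_val (ldiv a b)).
rewrite -orbit_mesh_val_op; congr (ldiv _ (orbit_mesh_val _)).
by case: b => j b; rewrite /= /mesh_sum_op /= subrK.
Qed.

End TwoReductiveRack.

(** * Sums of trivial affine meshes *)

Section MeshIso.
Variables (X : algebra) (I : Type) (M : trivial_affine_mesh I).
Variable f : mesh_sum M -> X.
Hypothesis f_iso : algebra_iso f.

Let fop : forall a b, f (op a b) = op (f a) (f b).
Proof. by case: f_iso. Qed.

Let fldiv : forall a b, f (ldiv a b) = ldiv (f a) (f b).
Proof. by case: f_iso. Qed.

Let f_surj (x : X) : exists a, x = f a.
Proof. by case: f_iso => -[g _ gK] _ _; exists (g x). Qed.

Lemma mesh_iso_rack : rack X.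
Proof.
split=> [x y|x y z]; have [a ->] := f_surj x; have [b ->] := f_surj y.
  rewrite -!fop -!fldiv -!fop; case: b => j b.
  by rewrite /= /mesh_sum_op /mesh_sum_ldiv /= subrK addrK.
have [c ->] := f_surj z; rewrite -!fop; congr f; case: c => k c.
by rewrite /= /mesh_sum_op /= addrAC.
Qed.

Lemma mesh_iso_two_reductive : two_reductive X.
Proof.
by move=> x y z; have [a ->] := f_surj x; have [b ->] := f_surj y;
  have [c ->] := f_surj z; rewrite -!fop.
Qed.

Let Ggrp : perm_group (LMlt X) := LMlt_perm_group mesh_iso_rack.1.

(** Left translations of the sum preserve the blocks, and the permutations doing
    so form a group. *)
Lemma LMlt_tag g a : LMlt X g -> exists b, g (f a) = f b /\ tag b = tag a.
Proof.
have [[h fK hK] _ _] := f_iso.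
pose P := [set g | bijective g /\ forall x, tag (h (g x)) = tag (h x)].
move=> Gg; suff /(_ _ Gg) [_ gP] : LMlt X `<=` P.
  by exists (h (g (f a))); rewrite hK gP fK.
apply: LMlt_sub.
  split; first by move=> k [].
  - by split=> //; exists id.
  - move=> k l [k_bij kE] [l_bij lE]; split; first exact: bij_comp.
    by move=> x /=; rewrite kE lE.
  - move=> k l [_ kE] kK lK; split; first by exists k.
    by move=> x; rewrite -{2}(lK x) kE.
move=> x; split; first exact: left_quasigroup_bij mesh_iso_rack.1.
by move=> y; have [a1 ->] := f_surj x; have [b ->] := f_surj y;
  rewrite -fop !fK.
Qed.

(** The elements [c] for which such a [g] exists form a subgroup of [A_j]; it
    contains every [c_{i,j}], realized by left translation by any point of
    [A_i]. *)
Lemma LMlt_translation j (c : mesh_grp M j) : exists2 g, LMlt X g &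
  forall a, g (f (Tagged (mesh_grp M) a)) = f (Tagged (mesh_grp M) (a + c)).
Proof.
have [Gbij G1 GM GV] := Ggrp.
pose H : set (mesh_grp M j) := [set c | exists2 g, LMlt X g &
  forall a, g (f (Tagged (mesh_grp M) a)) = f (Tagged (mesh_grp M) (a + c))].
suff : subgroup_gen (range (mesh_cst M ^~ j)) `<=` H.
  by rewrite mesh_generated; apply.
apply: smallest_sub => [|_ [i _ <-]]; last first.
  exists (op (f (Tagged (mesh_grp M) (0 : mesh_grp M i)))); first exact: LMlt_op.
  by move=> a; rewrite -fop.
split=> [|x y]; rewrite !inE; first by exists id => // a; rewrite addr0.
move=> [g Gg gE] [h Gh hE]; have [k hK kK] := Gbij h Gh.
exists (g \o k); first exact: GM Gg (GV h k Gh hK kK).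
by move=> a /=; rewrite -[a in LHS](subrK y) -hE hK gE addrAC addrA.
Qed.

Lemma orbit_of_mesh a : orbit_of (LMlt X) (f a) = f @` mesh_block M (tag a).
Proof.
apply/seteqP; split=> [_ [g Gg <-]|_ [_ [b _ <-] <-]].
  have [[i b] [-> ba]] := LMlt_tag a Gg; exists (existT _ i b) => //.
  by rewrite -ba; exists b.
case: a b => i a /= b; have [g Gg gE] := LMlt_translation (b - a).
by exists g; rewrite // gE addrC subrK.
Qed.

Lemma mesh_orbits :
  orbits (LMlt X) = [set f @` mesh_block M i | i in [set: I]].
Proof.
apply/seteqP; split=> [_ [x _ <-]|_ [i _ <-]].
  by have [a ->] := f_surj x; exists (tag a); rewrite // orbit_of_mesh.
by exists (f (Tagged (mesh_grp M) (0 : mesh_grp M i))); rewrite // orbit_of_mesh.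
Qed.

End MeshIso.

Theorem theorem3p6 (X : algebra) :
  (rack X /\ two_reductive X <->
   exists (I : Type) (M : trivial_affine_mesh I) (f : mesh_sum M -> X),
     algebra_iso f) /\
  (forall (I : Type) (M : trivial_affine_mesh I) (f : mesh_sum M -> X),
     algebra_iso f ->
     orbits (LMlt X) = [set f @` mesh_block M i | i in [set: I]]).
Proof.
split; last exact: mesh_orbits.
split=> [[rackX redX]|[I [M [f f_iso]]]].
  exists (orbit_index X), (orbit_mesh rackX redX), (@orbit_mesh_val _ _ _).
  exact: orbit_mesh_iso.
by split; [exact: mesh_iso_rack f_iso | exact: mesh_iso_two_reductive f_iso].
Qed.
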